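(* Let $n\ge2$ and let $\mathcal{L}$ be the Laplacian of a strongly connected, weight-balanced directed graph on $[n]$. Let $\mathcal{L}^{\dagger}_s:=\tfrac12(\mathcal{L}^{\dagger}+(\mathcal{L}^{\dagger})^{\top})$, $R(a,b):=(\bm{1}_a-\bm{1}_b)^{\top}\mathcal{L}^{\dagger}_s(\bm{1}_a-\bm{1}_b)$ and $\Omega:=(R(a,b))_{a,b\in[n]}$. Define the resistance radius set function by $\sigma^2(\mathcal{V}):=\tfrac12(\bm{1}^{\top}\Omega[\mathcal{V},\mathcal{V}]^{-1}\bm{1})^{-1}$ for $\mathcal{V}\subseteq[n]$ with $|\mathcal{V}|\ge2$, and $\sigma^2(\emptyset)=\sigma^2(\{i\})=0$ for all $i\in[n]$. Then: (1) for any $\mathcal{V},\mathcal{W}\subseteq[n]$ with $\mathcal{V}\subsetneq\mathcal{W}$, $\sigma^2(\mathcal{V})\le\sigma^2(\mathcal{W})$; (2) for any $i,j\in[n]$ with $i\ne j$, $\sigma^2(\{i,j\})=R(i,j)/4>0$.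
   Context: A directed graph on $[n]$ has weighted adjacency matrix $\mathcal{A}\ge0$ with zero diagonal and Laplacian $\mathcal{L}=\mathcal{D}-\mathcal{A}$, $\mathcal{D}$ the diagonal matrix of row sums. Strongly connected: a directed path exists between every ordered pair of nodes. Weight-balanced: $\mathcal{L}^{\top}\bm{1}=\bm{0}$. $\dagger$ is the Moore–Penrose pseudoinverse; $\Omega[\mathcal{V},\mathcal{V}]$ is the principal submatrix indexed by $\mathcal{V}$ (invertible when $|\mathcal{V}|\ge2$); $\bm{1}$ is the all-ones vector of the appropriate dimension and $\bm{1}_i$ the $i$-th standard basis vector. *)

(* Defs.v *)
From mathcomp Require Import all_boot all_order all_algebra.
From mathcomp Require Import boolp classical_sets reals.

Set Implicit Arguments.
Unset Strict Implicit.
Unset Printing Implicit Defensive.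

Import Order.TTheory GRing.Theory Num.Theory.
Local Open Scope ring_scope.

Section MoorePenrose.
Variable R : realType.

(* The four Penrose equations; over the reals the adjoint is the transpose. *)
Definition is_mpinv m n (A : 'M[R]_(m, n)) (X : 'M[R]_(n, m)) : Prop :=
  [/\ A *m X *m A = A,
      X *m A *m X = X,
      (A *m X)^T = A *m X
    & (X *m A)^T = X *m A].

Definition mpinv m n (A : 'M[R]_(m, n)) : 'M[R]_(n, m) :=
  xget 0 [set X | is_mpinv A X]%classic.

Lemma mulmx_tr_eq0 m n (A : 'M[R]_(m, n)) : A *m A^T = 0 -> A = 0.
Proof.
move=> A0; apply/matrixP => i j; rewrite mxE.
have /eqP := congr1 (fun M : 'M_m => M i i) A0; rewrite !mxE.
rewrite psumr_eq0 => [|k _]; last by rewrite mxE -expr2 sqr_ge0.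
by move=> /allP/(_ j); rewrite mem_index_enum mxE -expr2 sqrf_eq0 => /(_ isT)/eqP.
Qed.

Lemma row_free_gram_unit m n (F : 'M[R]_(m, n)) :
  row_free F -> F *m F^T \in unitmx.
Proof.
move=> Ffree; rewrite -row_free_unit -kermx_eq0; apply/eqP.
set K := kermx _; have KFF : K *m (F *m F^T) = 0 by apply: mulmx_ker.
have KF : K *m F = 0.
  by apply: mulmx_tr_eq0; rewrite trmx_mul mulmxA -(mulmxA K) KFF mul0mx.
by apply: (row_free_inj Ffree); rewrite KF mul0mx.
Qed.

Lemma mpinv_exists m n (A : 'M[R]_(m, n)) : exists X, is_mpinv A X.
Proof.
have [r [C [F [AE FU CU]]]] : exists r (C : 'M[R]_(m, r)) (F : 'M[R]_(r, n)),
    [/\ A = C *m F, F *m F^T \in unitmx & C^T *m C \in unitmx].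
  exists (\rank A), (col_base A), (row_base A); split.
  - by rewrite mulmx_base.
  - exact/row_free_gram_unit/row_base_free.
  - rewrite -{2}[col_base A]trmxK; apply: row_free_gram_unit.
    by rewrite /row_free mxrank_tr -/(row_full _) col_base_full.
pose G := invmx (F *m F^T); pose H := invmx (C^T *m C).
have GT : G^T = G by rewrite /G trmx_inv trmx_mul trmxK.
have HT : H^T = H by rewrite /H trmx_inv trmx_mul trmxK.
pose X := F^T *m G *m (H *m C^T).
have AX : A *m X = C *m H *m C^T.
  by rewrite AE /X !mulmxA -(mulmxA C F) -(mulmxA C _ G) mulmxV // mulmx1.
have XA : X *m A = F^T *m G *m F.
  by rewrite AE /X !mulmxA -(mulmxA _ C^T C) -(mulmxA _ H) mulVmx // mulmx1.
exists X; split.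
- by rewrite AX AE -!mulmxA (mulmxA C^T) (mulmxA H) mulVmx // mul1mx.
- by rewrite XA /X -!mulmxA (mulmxA F F^T) (mulmxA G (F *m _)) mulVmx // mul1mx.
- by rewrite AX !trmx_mul trmxK HT mulmxA.
- by rewrite XA !trmx_mul trmxK GT mulmxA.
Qed.

Lemma mpinvP m n (A : 'M[R]_(m, n)) : is_mpinv A (mpinv A).
Proof. by have [X AX] := mpinv_exists A; apply: (xgetPex 0); exists X. Qed.

Lemma mpinv_unique m n (A : 'M[R]_(m, n)) X Y :
  is_mpinv A X -> is_mpinv A Y -> X = Y.
Proof.
move=> [AXA XAX AXT XAT] [AYA YAY AYT YAT].
have AXY : A *m X = A *m Y.
  by rewrite -{1}AYA -mulmxA -AYT -AXT -trmx_mul mulmxA AXA AYT.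
have XAY : X *m A = Y *m A.
  by rewrite -{1}AYA -mulmxA mulmxA -XAT -YAT -trmx_mul -mulmxA (mulmxA A) AXA YAT.
by rewrite -XAX XAY -mulmxA AXY mulmxA YAY.
Qed.

End MoorePenrose.

Section ResistanceRadius.
Variables (R : realType) (n : nat).
Implicit Types (A L : 'M[R]_n) (V : {set 'I_n}).

Definition is_adjacency A : Prop :=
  (forall i j, 0 <= A i j) /\ (forall i, A i i = 0).

Definition laplacian A : 'M[R]_n :=
  diag_mx (\row_i \sum_j A i j) - A.

(* connect is the reflexive-transitive closure, so a pair (i, i) is joined by
   the empty path. *)
Definition strongly_connected A : Prop :=
  forall i j, connect [rel u v | 0 < A u v] i j.

Definition weight_balanced A : Prop :=
  (laplacian A)^T *m (const_mx 1 : 'cV[R]_n) = 0.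

Definition mpinv_sym L : 'M[R]_n := 2^-1 *: (mpinv L + (mpinv L)^T).

Definition basis_vec (i : 'I_n) : 'cV[R]_n := delta_mx i 0.

Definition resistance L (a b : 'I_n) : R :=
  let d := basis_vec a - basis_vec b in (d^T *m mpinv_sym L *m d) 0 0.

Definition resistance_mx L : 'M[R]_n := \matrix_(a, b) resistance L a b.

Definition principal_submx (M : 'M[R]_n) V : 'M[R]_#|V| :=
  mxsub (@enum_val _ (mem V)) (@enum_val _ (mem V)) M.

Definition resistance_radius L V : R :=
  if (2 <= #|V|)%N then
    let u : 'cV[R]_#|V| := const_mx 1 in
    2^-1 * ((u^T *m invmx (principal_submx (resistance_mx L) V) *m u) 0 0)^-1
  else 0.

End ResistanceRadius.

(* Main.v *)
Require Import Defs.
From mathcomp Require Import all_boot all_order all_algebra.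
From mathcomp Require Import reals ring lra.

Set Implicit Arguments.
Unset Strict Implicit.

Import Order.TTheory GRing.Theory Num.Theory.
Local Open Scope ring_scope.

(** The symmetrised pseudoinverse is positive definite on the vectors of zero
    sum, so the resistance matrix is negative definite there.  A Lagrange
    multiplier computation then identifies [2 * sigma^2(V)] with the maximum of
    [x^T Omega x] over the vectors [x] of total mass [1] supported in [V]; this
    also holds for singletons, where the maximum is [0].  Enlarging [V] enlarges
    the feasible set, and for [V = {i, j}] one maximises [2 t (1 - t) R(i, j)]. *)

(** * Quadratic forms and total mass of vectors *)

Section QuadraticForms.
Variable R : realType.

Definition qform {n} (M : 'M[R]_n) (x : 'cV[R]_n) : R := (x^T *m M *m x) 0 0.

Definition mass {n} (x : 'cV[R]_n) : R := ((const_mx 1 : 'cV[R]_n)^T *m x) 0 0.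

(** Strict conditional negative definiteness, the property that distinguishes Euclidean
    squared-distance matrices of affinely independent points. *)
Definition neg_def_on_mass0 {n} (K : 'M[R]_n) : Prop :=
  forall x : 'cV[R]_n, mass x = 0 -> x != 0 -> qform K x < 0.

Lemma massE n (x : 'cV[R]_n) : mass x = \sum_i x i 0.
Proof. by rewrite /mass mxE; apply: eq_bigr => i _; rewrite !mxE mul1r. Qed.

Lemma massB n (x y : 'cV[R]_n) : mass (x - y) = mass x - mass y.
Proof. by rewrite /mass mulmxBr !mxE. Qed.

Lemma massZ n c (x : 'cV[R]_n) : mass (c *: x) = c * mass x.
Proof. by rewrite /mass -scalemxAr mxE. Qed.

Lemma mass_const_eq0 n (c : R) :
  mass (const_mx c : 'cV[R]_n) = 0 -> const_mx c = 0 :> 'cV[R]_n.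
Proof.
case: n => [|n]; first by move=> _; apply/matrixP => - [].
rewrite massE (eq_bigr (fun=> c)) => [|i _]; last by rewrite mxE.
rewrite sumr_const card_ord => /eqP; rewrite mulrn_eq0 /= => /eqP ->.
by apply/matrixP => i j; rewrite !mxE.
Qed.

Lemma mass_basis_vec n (i : 'I_n) : mass (basis_vec R i) = 1.
Proof.
rewrite massE (bigD1 i) //= big1 ?addr0; first by rewrite mxE !eqxx.
by move=> j ji; rewrite mxE (negPf ji).
Qed.

Lemma qformE n (M : 'M[R]_n) x : qform M x = \sum_i \sum_j x i 0 * M i j * x j 0.
Proof.
rewrite /qform mxE exchange_big; apply: eq_bigr => j _.
by rewrite mxE mulr_suml; apply: eq_bigr => i _; rewrite mxE.
Qed.

Lemma qform_tr n (M : 'M[R]_n) x : qform M^T x = qform M x.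
Proof.
rewrite !qformE exchange_big; apply: eq_bigr => i _; apply: eq_bigr => j _.
by rewrite mxE; ring.
Qed.

Lemma qformD n (M N : 'M[R]_n) x : qform (M + N) x = qform M x + qform N x.
Proof. by rewrite /qform mulmxDr mulmxDl mxE. Qed.

Lemma qformZl n c (M : 'M[R]_n) x : qform (c *: M) x = c * qform M x.
Proof. by rewrite /qform -scalemxAr -scalemxAl mxE. Qed.

Lemma qformZr n c (M : 'M[R]_n) x : qform M (c *: x) = c ^+ 2 * qform M x.
Proof.
by rewrite /qform [(c *: x)^T]linearZ /= -!scalemxAl -scalemxAr !mxE expr2 mulrA.
Qed.

Lemma qform_sym_sub n (K : 'M[R]_n) (y x : 'cV[R]_n) : K^T = K ->
  qform K (y - x) = qform K y - 2 * (y^T *m K *m x) 0 0 + qform K x.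
Proof.
move=> KT; have xKy : (x^T *m K *m y) 0 0 = (y^T *m K *m x) 0 0.
  have -> : x^T *m K *m y = (y^T *m K *m x)^T by rewrite !trmx_mul trmxK KT mulmxA.
  by rewrite mxE.
rewrite /qform [(y - x)^T]linearB /= !mulmxBl !mulmxBr.
by move: xKy; rewrite !mxE => ->; ring.
Qed.

Lemma qform_congr m n (M : 'M[R]_m) (E : 'M[R]_(m, n)) x :
  qform (E^T *m M *m E) x = qform M (E *m x).
Proof. by rewrite /qform trmx_mul !mulmxA. Qed.

Lemma neg_def_mass0_le0 n (K : 'M[R]_n) x :
  neg_def_on_mass0 K -> mass x = 0 -> qform K x <= 0.
Proof.
move=> Kneg x0; have [-> | xN0] := eqVneq x 0; last exact/ltW/Kneg.
by rewrite /qform mulmx0 mxE.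
Qed.

(** * Maximising a conditionally negative definite form over unit mass *)

Section LagrangeMultiplier.
Variables (n : nat) (K : 'M[R]_n) (z : 'cV[R]_n).
Hypotheses (KT : K^T = K) (Kneg : neg_def_on_mass0 K).
Hypotheses (z1 : mass z = 1) (zpos : 0 < qform K z).

Let u : 'cV[R]_n := const_mx 1.
Let c := (u^T *m invmx K *m u) 0 0.
(** The critical point of the form under the constraint [mass = 1]: there [K *m p] is proportional
    to the constraint gradient [u]. *)
Let p := c^-1 *: (invmx K *m u).

(** A nonzero kernel vector of mass 0 would violate [Kneg]. One of nonzero mass can be rescaled and
    subtracted from [z], which brings the mass to 0 but leaves the positive value [qform K z]
    unchanged. *)
Lemma neg_def_mass0_unitmx : K \in unitmx.
Proof.
rewrite -unitmx_tr -row_free_unit; apply/inj_row_free => v vK0.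
have Kv0 : K *m v^T = 0 by rewrite -[RHS]trmx0 -vK0 trmx_mul trmxK.
have qv w : (w^T *m K *m v^T) 0 0 = 0 by rewrite -mulmxA Kv0 mulmx0 mxE.
have qv0 : qform K v^T = 0 by apply: qv.
have [m0 | mN0] := eqVneq (mass v^T) 0.
  apply/trmx_inj; rewrite trmx0; apply/eqP; apply: contraTT isT => vN0.
  by have := Kneg m0 vN0; rewrite qv0 ltxx.
have /(neg_def_mass0_le0 Kneg) : mass (z - (mass v^T)^-1 *: v^T) = 0.
  by rewrite massB massZ z1 mulVf // subrr.
rewrite qform_sym_sub // qformZr qv0 -scalemxAr mxE qv !mulr0 subr0 addr0.
by rewrite leNgt zpos.
Qed.

Let Kp : K *m p = c^-1 *: u.
Proof. by rewrite -scalemxAr mulmxA mulmxV ?mul1mx ?neg_def_mass0_unitmx. Qed.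

(** The number [c] is both the mass of [invmx K *m u] and the value of the form there. If it were 0,
    [Kneg] would force this vector, and hence [u], to vanish. *)
Let cN0 : c != 0.
Proof.
apply/eqP => c0; have m0 : mass (invmx K *m u) = 0 by rewrite /mass mulmxA.
have q0 : qform K (invmx K *m u) = 0.
  rewrite /qform -mulmxA (mulmxA K) mulmxV ?neg_def_mass0_unitmx // mul1mx.
  by rewrite -[_ *m _]trmxK trmx_mul trmxK mxE.
have [w0 | wN0] := eqVneq (invmx K *m u) 0; last by have := Kneg m0 wN0; rewrite q0 ltxx.
have u0 : u = 0.
  by rewrite -[u]mul1mx -(mulmxV neg_def_mass0_unitmx) -mulmxA w0 mulmx0.
by move/eqP: z1; rewrite /mass -/u u0 trmx0 mul0mx mxE eq_sym oner_eq0.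
Qed.

Lemma mass_maximizer : mass p = 1.
Proof. by rewrite massZ /mass mulmxA mulVf. Qed.

Let qform_p y : mass y = 1 -> (y^T *m K *m p) 0 0 = c^-1.
Proof.
move=> y1; rewrite -mulmxA Kp -scalemxAr mxE -[y^T *m u]trmxK trmx_mul trmxK mxE.
by rewrite -/(mass y) y1 mulr1.
Qed.

Lemma qform_maximizer : qform K p = c^-1.
Proof. exact/qform_p/mass_maximizer. Qed.

(** Completing the square at [p]: the cross term is [c^-1] for every [y] of mass 1, so
    [qform K y - c^-1] is the value at [y - p], which has mass 0. *)
Lemma qform_le_maximizer y : mass y = 1 -> qform K y <= c^-1.
Proof.
move=> y1; have /(neg_def_mass0_le0 Kneg) : mass (y - p) = 0.
  by rewrite massB y1 mass_maximizer subrr.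
rewrite qform_sym_sub // qform_p // qform_maximizer; lra.
Qed.

End LagrangeMultiplier.
End QuadraticForms.

(** * The Laplacian, its pseudoinverse and the resistance matrix *)

Section Laplacian.
Variables (R : realType) (n : nat) (A : 'M[R]_n).
Hypotheses (Aadj : is_adjacency A) (Aconn : strongly_connected A).
Hypothesis (Abal : weight_balanced A).

Let L := laplacian A.

Lemma laplacianE i j : L i j = (\sum_k A i k) *+ (i == j) - A i j.
Proof. by rewrite !mxE. Qed.

Lemma laplacian_const (c : R) : L *m (const_mx c : 'cV[R]_n) = 0.
Proof.
apply/matrixP => i j; rewrite mxE [RHS]mxE.
under eq_bigr do rewrite [const_mx _ _ _]mxE laplacianE mulrBl.
rewrite sumrB (bigD1 i) //= eqxx [X in _ + X - _]big1 ?addr0 => [|k ki]; last first.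
  by rewrite eq_sym (negPf ki) mulr0n mul0r.
by rewrite mulr1n mulr_suml subrr.
Qed.

Lemma weight_balanced_sums i : \sum_j A j i = \sum_j A i j.
Proof.
have /matrixP/(_ i 0) := Abal; rewrite mxE [RHS]mxE.
under eq_bigr do rewrite [const_mx _ _ _]mxE mulr1 [_^T _ _]mxE -/L laplacianE.
rewrite sumrB (bigD1 i) //= eqxx [X in _ + X - _]big1 ?addr0 => [|k ki]; last first.
  by rewrite (negPf ki).
by rewrite mulr1n => /eqP; rewrite subr_eq0 => /eqP.
Qed.

(** Balance makes the weighted squares summed over heads equal those summed over tails, so the two
    copies of the form combine into squared differences. *)
Lemma qform_laplacian (x : 'cV[R]_n) :
  2 * qform L x = \sum_i \sum_j A i j * (x i 0 - x j 0) ^+ 2.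
Proof.
have qL : qform L x =
    \sum_i \sum_j A i j * x i 0 ^+ 2 - \sum_i \sum_j A i j * x i 0 * x j 0.
  rewrite qformE -sumrB; apply: eq_bigr => i _.
  under eq_bigr do rewrite laplacianE mulrBr mulrBl.
  rewrite sumrB; congr (_ - _); last by apply: eq_bigr => j _; rewrite (mulrC (A i j)).
  rewrite (bigD1 i) //= eqxx [X in _ + X]big1 ?addr0 => [|k ki]; last first.
    by rewrite eq_sym (negPf ki) mulr0n mulr0 mul0r.
  by rewrite mulr1n -mulr_suml; ring.
have qLT : \sum_i \sum_j A i j * x j 0 ^+ 2 = \sum_i \sum_j A i j * x i 0 ^+ 2.
  rewrite exchange_big; apply: eq_bigr => i _.
  by rewrite -!mulr_suml weight_balanced_sums.
rewrite mulr_natl mulr2n {1}qL qL -{1}qLT -!sumrB -big_split; apply: eq_bigr => i _ /=.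
by rewrite -!sumrB -big_split; apply: eq_bigr => j _ /=; ring.
Qed.

Lemma qform_laplacian_ge0 (x : 'cV[R]_n) : 0 <= qform L x.
Proof.
rewrite -(pmulr_rge0 _ (ltr0n R 2)) qform_laplacian.
by do 2!(apply: sumr_ge0 => ? _); rewrite mulr_ge0 ?sqr_ge0 // Aadj.1.
Qed.

(** Every term of the sum of squares vanishes, so [x] agrees at the ends of each edge, and a
    directed path carries this to any pair of nodes. *)
Lemma qform_laplacian_eq0 (x : 'cV[R]_n) :
  qform L x = 0 -> exists c, x = const_mx c.
Proof.
move=> q0; have := qform_laplacian x; rewrite q0 mulr0 => /esym/eqP.
have Tge0 i j : 0 <= A i j * (x i 0 - x j 0) ^+ 2 by rewrite mulr_ge0 ?sqr_ge0 // Aadj.1.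
rewrite psumr_eq0 => [/allP S0|i _]; last exact: sumr_ge0.
have edge i j : 0 < A i j -> x i 0 = x j 0.
  move=> Aij; have := S0 i (mem_index_enum i); rewrite psumr_eq0 //.
  move=> /allP/(_ j (mem_index_enum j)); rewrite mulf_eq0 gt_eqF //= sqrf_eq0.
  by rewrite subr_eq0 => /eqP.
have xconst i j : x i 0 = x j 0.
  have /connectP[s] := Aconn i j.
  elim: s i => [|k s IH] i /=; first by move=> _ ->.
  by move=> /andP[/edge -> /IH].
case: n x xconst {q0 S0 Tge0 edge} => [|m] x xconst.
  by exists 0; apply/matrixP => - [].
by exists (x 0 0); apply/matrixP => i j; rewrite ord1 mxE.
Qed.

(** The residual [y] of the least-squares solution is killed by [L^T], hence is constant. Balance
    gives the image of [L] mass 0, so [y] has mass 0 as well and must vanish. *)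
Lemma mass0_laplacian_image (x : 'cV[R]_n) :
  mass x = 0 -> x = L *m (mpinv L *m x).
Proof.
move=> x0; have [LXL _ LXT _] := mpinvP L.
pose y := x - L *m (mpinv L *m x).
have LTy : L^T *m y = 0.
  by rewrite mulmxBr !mulmxA -(mulmxA L^T) -LXT -trmx_mul LXL subrr.
have [c yc] : exists c, y = const_mx c.
  by apply: qform_laplacian_eq0; rewrite -qform_tr /qform -mulmxA LTy mulmx0 mxE.
have my0 : mass y = 0.
  rewrite massB x0 /mass mulmxA -[_ *m L]trmxK trmx_mul trmxK.
  by rewrite [L^T *m _]Abal trmx0 mul0mx mxE subrr.
apply/eqP; rewrite -subr_eq0 -/y yc; apply/eqP/mass_const_eq0.
by rewrite -yc.
Qed.

(** With [w = mpinv L *m x] and [x = L *m w], the form of the pseudoinverse at [x] is the form of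
    [L] at [w]; it vanishes only for constant [w], which would give [x = 0]. *)
Lemma qform_mpinv_gt0 (x : 'cV[R]_n) :
  mass x = 0 -> x != 0 -> 0 < qform (mpinv L) x.
Proof.
move=> /mass0_laplacian_image xE xN0; set w := mpinv L *m x in xE.
have -> : qform (mpinv L) x = qform L w.
  by rewrite -[RHS]qform_tr /qform -mulmxA -/w {1}xE trmx_mul.
rewrite lt_def qform_laplacian_ge0 andbT; apply: contraNneq xN0.
by move=> /qform_laplacian_eq0[c wc]; rewrite xE wc laplacian_const.
Qed.

Lemma qform_mpinv_sym x : qform (mpinv_sym L) x = qform (mpinv L) x.
Proof. by rewrite qformZl qformD qform_tr; lra. Qed.

Lemma mpinv_symT : (mpinv_sym L)^T = mpinv_sym L.
Proof. by rewrite /mpinv_sym linearZ /= linearD /= trmxK addrC. Qed.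

Lemma resistanceE a b : resistance L a b =
  mpinv_sym L a a + mpinv_sym L b b - 2 * mpinv_sym L a b.
Proof.
have bil i j : ((basis_vec R i)^T *m mpinv_sym L *m basis_vec R j) 0 0 = mpinv_sym L i j.
  by rewrite trmx_delta -rowE -colE !mxE.
rewrite /resistance -/(qform _ _) qform_sym_sub ?mpinv_symT //.
by rewrite /qform !bil; ring.
Qed.

Lemma resistance_mxT : (resistance_mx L)^T = resistance_mx L.
Proof.
apply/matrixP => a b; rewrite !mxE !resistanceE.
by rewrite -[in mpinv_sym L b a]mpinv_symT [_^T _ _]mxE; ring.
Qed.

Lemma resistance_diag a : resistance L a a = 0.
Proof. by rewrite resistanceE; ring. Qed.

Lemma resistance_gt0 a b : a != b -> 0 < resistance L a b.
Proof.
move=> ab; rewrite /resistance -/(qform _ _) qform_mpinv_sym.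
apply: qform_mpinv_gt0; first by rewrite massB !mass_basis_vec subrr.
apply/eqP => /matrixP/(_ a 0)/eqP.
by rewrite !mxE !eqxx (negPf ab) subr0 oner_eq0.
Qed.

(** Expanding each resistance, the two diagonal contributions factor through the mass of [x] and
    drop out, leaving [-2] times the form of [mpinv_sym L]. *)
Lemma resistance_mx_neg_def : neg_def_on_mass0 (resistance_mx L).
Proof.
move=> x x0 xN0; have := qform_mpinv_gt0 x0 xN0; rewrite -qform_mpinv_sym.
suff -> : qform (resistance_mx L) x = - 2 * qform (mpinv_sym L) x by lra.
move: x0; rewrite massE => x0; set M := mpinv_sym L.
have S1 : \sum_i \sum_j x i 0 * M i i * x j 0 = 0.
  by apply: big1 => i _; rewrite -mulr_sumr x0 mulr0.
have S2 : \sum_i \sum_j x i 0 * M j j * x j 0 = 0.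
  rewrite exchange_big; apply: big1 => j _.
  by under eq_bigr do rewrite -mulrA; rewrite -mulr_suml x0 mul0r.
rewrite -[RHS]add0r -[X in X + _]S1 -[RHS]add0r -[X in X + (_ + _)]S2.
rewrite !qformE mulr_sumr -!big_split; apply: eq_bigr => i _ /=.
rewrite mulr_sumr -!big_split; apply: eq_bigr => j _ /=.
by rewrite mxE resistanceE -/M; ring.
Qed.

End Laplacian.

(** * Vectors supported in a node set, and extension by zero *)

Section Support.
Variables (R : realType) (n : nat).
Implicit Types (V W : {set 'I_n}) (x y : 'cV[R]_n).

Definition supported V x : Prop := forall a, a \notin V -> x a 0 = 0.

(** Extension by zero from [V] to all nodes; its transpose is restriction to [V]. *)
Definition extension_mx V : 'M[R]_(n, #|V|) := colsub (@enum_val _ (mem V)) 1%:M.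

Lemma supportedS V W x : V \subset W -> supported V x -> supported W x.
Proof. by move=> /subsetP VW xV a aW; apply/xV/(contra (VW a)). Qed.

Lemma supported_basis_vec V a : a \in V -> supported V (basis_vec R a).
Proof.
by move=> aV b bV; rewrite mxE andbT; case: eqP => // ba; rewrite ba aV in bV.
Qed.

Lemma supported_pair (a b : 'I_n) (s t : R) :
  supported [set a; b] (s *: basis_vec R a + t *: basis_vec R b).
Proof.
by move=> c; rewrite !inE negb_or !mxE => /andP[/negPf-> /negPf->]; rewrite !mulr0 addr0.
Qed.

Lemma mass_pair (a b : 'I_n) (s t : R) :
  mass (s *: basis_vec R a + t *: basis_vec R b) = s + t.
Proof. by rewrite -[t *: _]opprK massB -scaleNr !massZ !mass_basis_vec; ring. Qed.

Lemma supported_pairE a b x : a != b -> supported [set a; b] x ->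
  x = x a 0 *: basis_vec R a + x b 0 *: basis_vec R b.
Proof.
move=> ab xS; apply/matrixP => c k; rewrite ord1 !mxE !andbT.
have [-> | ca] := eqVneq c a; first by rewrite (negPf ab) mulr1 mulr0 addr0.
have [-> | cb] := eqVneq c b; first by rewrite mulr1 mulr0 add0r.
by rewrite !mulr0 addr0; apply: xS; rewrite !inE negb_or ca.
Qed.

Lemma supported_singletonE a x : supported [set a] x -> x = mass x *: basis_vec R a.
Proof.
move=> xS; have xE : x = x a 0 *: basis_vec R a.
  apply/matrixP => c k; rewrite ord1 !mxE andbT.
  have [-> | ca] := eqVneq c a; first by rewrite mulr1.
  by rewrite mulr0; apply: xS; rewrite inE.
by rewrite {1}xE {2}xE massZ mass_basis_vec mulr1.
Qed.

Lemma principal_submxE (M : 'M[R]_n) V :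
  principal_submx M V = (extension_mx V)^T *m M *m extension_mx V.
Proof.
rewrite /extension_mx mulmx_colsub mulmx1 trmx_mxsub trmx1 -rowsubE.
by apply/matrixP => i j; rewrite !mxE.
Qed.

Lemma extension_mxK V : (extension_mx V)^T *m extension_mx V = 1%:M.
Proof.
rewrite -[X in X *m _]mulmx1 -principal_submxE; apply/matrixP => i j.
by rewrite !mxE (inj_eq enum_val_inj).
Qed.

Lemma mass_extension V (y : 'cV[R]_#|V|) : mass (extension_mx V *m y) = mass y.
Proof.
rewrite /mass mulmxA mulmx_colsub mulmx1; congr ((_ *m _) 0 0).
by apply/matrixP => i j; rewrite !mxE.
Qed.

Lemma extension_mxE V (y : 'cV[R]_#|V|) a :
  (extension_mx V *m y) a 0 = \sum_i (a == enum_val i)%:R * y i 0.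
Proof. by rewrite mxE; apply: eq_bigr => i _; rewrite !mxE. Qed.

Lemma supported_extension V (y : 'cV[R]_#|V|) : supported V (extension_mx V *m y).
Proof.
move=> a aV; rewrite extension_mxE big1 // => i _.
by case: eqP => [ai | _]; [rewrite ai enum_valP in aV | rewrite mul0r].
Qed.

Lemma supported_extensionE V x :
  supported V x -> extension_mx V *m ((extension_mx V)^T *m x) = x.
Proof.
move=> xV; apply/matrixP => a k; rewrite ord1 extension_mxE.
rewrite trmx_mxsub trmx1 -rowsubE.
under eq_bigr do rewrite [rowsub _ _ _ _]mxE.
rewrite -(big_enum_val (fun b => (a == b)%:R * x b 0)).
have [aV | /xV xa0] := boolP (a \in V).
  rewrite (bigD1 a) //= eqxx mul1r big1 ?addr0 // => b /andP[_ ba].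
  by rewrite eq_sym (negPf ba) mul0r.
rewrite xa0 big1 // => b _; case: eqP => [<- | _]; last by rewrite mul0r.
by rewrite xa0 mulr0.
Qed.

End Support.

(** * The resistance radius as a constrained maximum *)

Section RadiusIsMaximum.
Variables (R : realType) (n : nat) (A : 'M[R]_n).
Hypotheses (Aadj : is_adjacency A) (Aconn : strongly_connected A).
Hypothesis (Abal : weight_balanced A).

Let L := laplacian A.
Let Om := resistance_mx L.

Lemma qform_resistance_pair a b (s t : R) :
  qform Om (s *: basis_vec R a + t *: basis_vec R b) = 2 * s * t * resistance L a b.
Proof.
have bil i j k l :
    ((k *: basis_vec R i)^T *m Om *m (l *: basis_vec R j)) 0 0 = k * l * resistance L i j.
  rewrite [(k *: _)^T]linearZ /= -!scalemxAl -scalemxAr trmx_delta -rowE -colE.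
  by rewrite !mxE mulrA.
rewrite -[t *: _]opprK -scaleNr qform_sym_sub ?resistance_mxT // /qform !bil.
by rewrite !resistance_diag; ring.
Qed.

Lemma principal_submx_neg_def (V : {set 'I_n}) :
  neg_def_on_mass0 (principal_submx Om V).
Proof.
move=> y y0 yN0; rewrite principal_submxE qform_congr.
apply: (resistance_mx_neg_def Aadj Aconn Abal); first by rewrite mass_extension.
apply: contraNneq yN0 => Ey0.
by rewrite -[y]mul1mx -(extension_mxK _ V) -mulmxA Ey0 mulmx0.
Qed.

Lemma principal_submxT (V : {set 'I_n}) :
  (principal_submx Om V)^T = principal_submx Om V.
Proof. by rewrite trmx_mxsub resistance_mxT. Qed.

Lemma resistance_radius_max (V : {set 'I_n}) : V != set0 ->
  (exists x, [/\ supported V x, mass x = 1 & qform Om x = 2 * resistance_radius L V])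
  /\ (forall y, supported V y -> mass y = 1 ->
        qform Om y <= 2 * resistance_radius L V).
Proof.
move=> VN0; rewrite /resistance_radius; case: ltnP => cV; last first.
  (* For a singleton the only feasible vector is [basis_vec R a], with value 0, which matches the
     conventional radius 0. *)
  have /cards1P[a ->] : #|V| == 1%N by rewrite eqn_leq cV card_gt0.
  have qa : qform Om (basis_vec R a) = 0.
    have := qform_resistance_pair a a 1 0.
    by rewrite scale1r scale0r addr0 mulr0 mul0r.
  rewrite mulr0; split=> [|y yS y1].
    exists (basis_vec R a); rewrite mass_basis_vec qa; split=> //.
    by apply: supported_basis_vec; rewrite inE.
  by rewrite (supported_singletonE yS) y1 scale1r qa.
have [a [b [aV bV ab]]] := card_gt1P cV.
(* The midpoint of two nodes of [V] has value [resistance L a b / 2]; it supplies the positive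
   vector [z] of mass 1 that the multiplier argument requires. *)
pose zf := 2^-1 *: basis_vec R a + 2^-1 *: basis_vec R b.
have zfV : supported V zf.
  by apply: supportedS (supported_pair _ _); rewrite subUset !sub1set aV.
pose z := (extension_mx R V)^T *m zf.
have Ez : extension_mx R V *m z = zf by apply: supported_extensionE.
set K := principal_submx _ V.
have qK y : qform K y = qform Om (extension_mx R V *m y).
  by rewrite /K principal_submxE qform_congr.
have z1 : mass z = 1 by rewrite -mass_extension Ez mass_pair; lra.
have zpos : 0 < qform K z.
  rewrite qK Ez qform_resistance_pair.
  by rewrite !mulr_gt0 ?invr_gt0 ?ltr0n // (resistance_gt0 Aadj Aconn Abal).
have KT : K^T = K by apply: principal_submxT.
have Kneg : neg_def_on_mass0 K by apply: principal_submx_neg_def.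
rewrite mulVKf ?pnatr_eq0 //; split=> [|y yV y1].
  pose u : 'cV[R]_#|V| := const_mx 1.
  pose p := ((u^T *m invmx K *m u) 0 0)^-1 *: (invmx K *m u).
  exists (extension_mx R V *m p); split; first exact: supported_extension.
    by rewrite mass_extension (mass_maximizer KT Kneg z1 zpos).
  by rewrite -qK (qform_maximizer KT Kneg z1 zpos).
rewrite -(supported_extensionE yV) -qK.
apply: (qform_le_maximizer KT Kneg z1 zpos).
by rewrite -mass_extension supported_extensionE.
Qed.

Lemma resistance_radius_set0 : resistance_radius L set0 = 0.
Proof. by apply: ifF; rewrite cards0. Qed.

(** A basis vector in [V] is feasible with value 0. This settles monotonicity from the empty set,
    which has no feasible vector. *)
Lemma resistance_radius_ge0 (V : {set 'I_n}) : 0 <= resistance_radius L V.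
Proof.
have [-> | VN0] := eqVneq V set0; first by rewrite resistance_radius_set0.
have [_ maxV] := resistance_radius_max VN0; have [a aV] := set0Pn _ VN0.
have := maxV _ (supported_basis_vec R aV) (mass_basis_vec R a).
have := qform_resistance_pair a a 1 0.
by rewrite scale1r scale0r addr0 mulr0 mul0r => ->; rewrite pmulr_rge0 ?ltr0n.
Qed.

Lemma resistance_radius_mono (V W : {set 'I_n}) :
  V \subset W -> resistance_radius L V <= resistance_radius L W.
Proof.
move=> VW; have [-> | VN0] := eqVneq V set0.
  by rewrite resistance_radius_set0 resistance_radius_ge0.
have WN0 : W != set0 by apply: contraNneq VN0 => W0; rewrite -subset0 -W0.
have [[x [xV x1 qx]] _] := resistance_radius_max VN0.
have [_ /(_ x (supportedS VW xV) x1)] := resistance_radius_max WN0.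
by rewrite qx ler_pM2l ?ltr0n.
Qed.

Lemma resistance_radius_pair a b :
  a != b -> resistance_radius L [set a; b] = resistance L a b / 4.
Proof.
move=> ab; have Rpos : 0 < resistance L a b by apply: resistance_gt0.
have VN0 : [set a; b] != set0 by apply/set0Pn; exists a; rewrite !inE eqxx.
have [[x [xV x1 qx]] maxV] := resistance_radius_max VN0.
have h1 : 2^-1 + 2^-1 = 1 :> R by lra.
(* Testing the midpoint gives the lower bound on the radius. *)
have := maxV _ (@supported_pair R n a b 2^-1 2^-1); rewrite mass_pair => /(_ h1).
move: x1 qx; rewrite (supported_pairE ab xV) mass_pair !qform_resistance_pair.
set s := x a 0; set t := x b 0; set r := resistance L a b in Rpos *.
move=> st; have -> : t = 1 - s by lra.
move=> qx ler; apply/eqP; rewrite eq_le; apply/andP; split; last by lra.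
(* For the upper bound, the maximiser has weights [s] and [1 - s], and
   [4 * s * (1 - s) = 1 - (2 * s - 1) ^+ 2]. *)
have : 0 <= r * (2 * s - 1) ^+ 2 by rewrite mulr_ge0 ?sqr_ge0 // ltW.
by move=> h; nra.
Qed.

End RadiusIsMaximum.

Unset Implicit Arguments.

Theorem theorem3p8 (R : realType) (n : nat) (A : 'M[R]_n) :
  (2 <= n)%N ->
  is_adjacency A -> strongly_connected A -> weight_balanced A ->
  let L := laplacian A in
  (forall V W : {set 'I_n}, V \proper W ->
     resistance_radius L V <= resistance_radius L W) /\
  (forall i j : 'I_n, i != j ->
     resistance_radius L [set i; j] = resistance L i j / 4 /\
     0 < resistance L i j / 4).
Proof.
move=> _ Aadj Aconn Abal L; split=> [V W /proper_sub VW | i j ij].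
  exact: resistance_radius_mono.
split; first exact: resistance_radius_pair.
by rewrite divr_gt0 ?ltr0n // resistance_gt0.
Qed.
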